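(* At $\nu=1/2$, the derivative of $u\mapsto u^2K_\nu'(u)$ is positive on $\bigl(\tfrac{1+\sqrt2}{2},\,2\bigr)$. Thus $u\mapsto u^2K_{1/2}'(u)$ is not strictly decreasing on $(0,2)$, and the statement ''for every real $\nu$ with $|\nu|\le1/2$, the function $u\mapsto u^2K_\nu'(u)$ is strictly decreasing on $(0,2)$'' is false.
   Context: $K_\nu$ is the modified Bessel function of the second kind of order $\nu$, with the standard normalization ($K_\nu(u)\sim(\pi/(2u))^{1/2}e^{-u}$ as $u\to\infty$); in particular $K_{1/2}(u)=\sqrt{\frac{\pi}{2u}}\,e^{-u}$ for $u>0$. The prime denotes the derivative in $u$. *)

(* Defs.v *)
From HB Require Import structures.
From mathcomp Require Import all_boot all_order all_algebra.
From mathcomp Require Import all_classical all_reals all_analysis.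

Set Implicit Arguments.
Unset Strict Implicit.
Unset Printing Implicit Defensive.

Import Order.TTheory GRing.Theory Num.Theory.
Import numFieldNormedType.Exports.

Local Open Scope classical_set_scope.
Local Open Scope ring_scope.

Definition cosh {R : realType} (t : R) : R := (expR t + expR (- t)) / 2.

(* The modified Bessel function of the second kind K_nu(u), by its standard
   integral representation
     K_nu(u) = \int_0^oo exp(- u cosh t) cosh(nu t) dt
   (DLMF 10.32.9), which holds for every real order nu, integers included, and
   every u > 0. This carries the normalization
     K_nu(u) ~ (pi / (2 u))^(1/2) exp(- u) as u -> +oo.
   For u <= 0 the integral diverges and the value is meaningless; only u > 0
   is ever used. *)
Definition besselK {R : realType} (nu u : R) : R :=
  \int[@lebesgue_measure R]_(t in `[0, +oo[) (expR (- u * cosh t) * cosh (nu * t)).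

(* u |-> u^2 K_nu'(u), the prime being the derivative in u. *)
Definition sqr_besselK' {R : realType} (nu u : R) : R :=
  u ^+ 2 * derive1 (besselK nu) u.

(* Main.v *)
Require Import Defs.
From HB Require Import structures.
From mathcomp Require Import all_boot all_order all_algebra.
From mathcomp Require Import all_classical all_reals all_analysis.
From mathcomp Require Import ring lra.

Import Order.TTheory GRing.Theory Num.Theory.
Import numFieldNormedType.Exports.

Local Open Scope ring_scope.

(** At order 1/2 the Bessel integral is elementary. The double-angle formula
    cosh t = 1 + 2 (sinh (t/2))^2 and the substitution r = (2 u)^(1/2) sinh (t/2)
    turn it into a multiple of the Gauss integral, which gives [besselK_half]:
      K_{1/2}(u) = (pi/2)^(1/2) u^(-1/2) exp(-u)   for u > 0.
    Differentiating this closed form twice,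
      u^2 K_{1/2}'(u) = - (pi/2)^(1/2) (u^(3/2) + u^(1/2) / 2) exp(-u),
      (u^2 K_{1/2}'(u))' = (pi/2)^(1/2) u^(-1/2) exp(-u) (u^2 - u - 1/4),
    and the quadratic factor has (1 + sqrt 2) / 2 as its larger root, so the
    derivative is positive beyond that point ([is_derive_sqr_besselK'_half] and
    [derive1_sqr_besselK'_half_gt0]). As sqrt 2 < 2, this point lies before 3/2,
    and the values at 3/2 < 7/4 < 2 already violate strict decrease; the order
    1/2 is then a counterexample to the claim for all orders in [-1/2, 1/2]. *)

(** * The inverse hyperbolic sine *)

Definition arsinh {R : realType} (x : R) : R := ln (x + Num.sqrt (1 + x ^+ 2)).

Lemma sqrt1Dsqr_gt0 {R : realType} (x : R) : 0 < Num.sqrt (1 + x ^+ 2).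
Proof. by rewrite sqrtr_gt0 ltr_pwDl ?sqr_ge0. Qed.

Lemma sqrt1DsqrK {R : realType} (x : R) :
  Num.sqrt (1 + x ^+ 2) ^+ 2 = 1 + x ^+ 2.
Proof. by rewrite sqr_sqrtr// addr_ge0 ?sqr_ge0. Qed.

(** Since |x| = sqrt (x^2) < sqrt (1 + x^2), the logarithm in [arsinh] is always
    taken of a positive number, whatever the sign of [x]. *)
Lemma arsinh_arg_gt0 {R : realType} (x : R) : 0 < x + Num.sqrt (1 + x ^+ 2).
Proof.
rewrite -ltrBlDl sub0r (le_lt_trans (ler_norm _))// normrN -sqrtr_sqr.
by rewrite ltr_sqrt ?ltr_pwDl ?sqr_ge0// ltrDr.
Qed.

Lemma is_derive_arsinh {R : realType} (x : R) :
  is_derive x 1 (@arsinh R) (Num.sqrt (1 + x ^+ 2))^-1.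
Proof.
have h0 := sqrt1Dsqr_gt0 x.
have a0 := arsinh_arg_gt0 x.
have r0 : 0 < 1 + x ^+ 2 by rewrite ltr_pwDl ?sqr_ge0.
have Dsqr : is_derive x 1 (fun y : R => 1 + y ^+ 2) (2 * x).
  by apply: is_derive_eq; rewrite add0r /GRing.scale/=; ring.
have Dsqrt : is_derive x 1 (fun y : R => Num.sqrt (1 + y ^+ 2))
    (x / Num.sqrt (1 + x ^+ 2)).
  have Ds := is_derive1_sqrt r0.
  apply: (is_derive_eq (is_derive1_comp (g := fun y : R => 1 + y ^+ 2) Ds Dsqr)).
  by field; rewrite gt_eqF.
have Darg : is_derive x 1 (fun y : R => y + Num.sqrt (1 + y ^+ 2))
   (1 + x / Num.sqrt (1 + x ^+ 2)) by exact: is_deriveD.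
have Dln := is_derive1_ln a0.
apply: (is_derive_eq (is_derive1_comp (g := fun y : R => y + Num.sqrt (1 + y ^+ 2)) Dln Darg)).
by field; rewrite !gt_eqF.
Qed.

(** The reciprocal of h + x is h - x, where h = sqrt (1 + x^2), because
    h^2 - x^2 = 1; hence exp(arsinh x) and exp(- arsinh x) average to h. *)
Lemma cosh_arsinh {R : realType} (x : R) :
  cosh (arsinh x) = Num.sqrt (1 + x ^+ 2).
Proof.
have a0 := arsinh_arg_gt0 x.
rewrite /cosh expRN lnK ?posrE//.
have /eqP := sqrt1DsqrK x; rewrite -subr_eq0 => /eqP E.
(* Clearing the denominators 2 and x + h leaves a multiple of E. *)
apply/eqP; rewrite -subr_eq0 -(mulrI_eq0 _ (@mulfI _ 2 _)) ?pnatr_eq0//.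
rewrite -(mulIr_eq0 _ (mulIf (lt0r_neq0 a0))).
by apply/eqP; rewrite -[RHS](oppr0 R) -E; field; rewrite gt_eqF.
Qed.

Lemma cosh_double {R : realType} (t : R) :
  cosh (2 * t) = 2 * cosh t ^+ 2 - 1.
Proof.
rewrite /cosh (_ : 2 * t = t + t); last by ring.
rewrite opprD !expRD expRN.
by field; rewrite gt_eqF// expR_gt0.
Qed.

Lemma cosh_continuous {R : realType} : continuous (@cosh R).
Proof.
move=> t; apply: cvgMr_tmp; apply: cvgD; first exact: continuous_expR.
apply: (@continuous_comp _ _ _ (fun x : R => - x) expR).
  exact: opp_continuous.
exact: continuous_expR.
Qed.

(** * The closed form of K at order 1/2 *)

Lemma cvg_sqrt1Dsqr_pinfty {R : realType} (c : R) : 0 < c ->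
  (Num.sqrt (1 + (c * x) ^+ 2) @[x --> +oo] --> +oo)%classic.
Proof.
move=> c0; apply: (@ger_cvgy _ _ _ _ (fun x => c * x)).
  near=> x.
  rewrite (le_trans (ler_norm _))// -sqrtr_sqr ler_sqrt ?lerDr//.
  by rewrite addr_ge0 ?sqr_ge0.
apply: gt0_cvgMry => //; exact: cvg_id.
Unshelve. all: by end_near. Qed.

Lemma cvg_arsinh_pinfty {R : realType} (c : R) : 0 < c ->
  (2 * arsinh (c * x) @[x --> +oo] --> +oo)%classic.
Proof.
move=> c0; apply: gt0_cvgMry => //; apply/cvgryPge => A.
have /cvgryPge/(_ (expR A)) := @cvg_sqrt1Dsqr_pinfty R c c0.
apply: filterS2 (nbhs_pinfty_ge (num_real 0)) => x x0 hx.
rewrite -ler_expR lnK ?posrE ?arsinh_arg_gt0// (le_trans hx)//.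
by rewrite lerDr mulr_ge0 // ltW.
Qed.

(** The substitution is performed as t = F(r) = 2 arsinh(c r) with
    c = (2 u)^(-1/2), from the Bessel integrand towards the Gaussian one: in
    this direction the derivative 2 c / sqrt (1 + (c r)^2) of the substitution
    has a finite limit at infinity, as the change-of-variables theorem demands,
    whereas the derivative of r = sinh(t/2) / c is unbounded. *)
Lemma besselK_half {R : realType} (u : R) : 0 < u ->
  besselK (1 / 2) u = Num.sqrt (pi / 2) * ((Num.sqrt u)^-1 * expR (- u)).
Proof.
move=> u0.
pose c : R := (Num.sqrt (2 * u))^-1.
have c0 : 0 < c by rewrite invr_gt0 sqrtr_gt0 mulr_gt0.
have cc : 2 * u * c ^+ 2 = 1.
  by rewrite exprVn sqr_sqrtr ?divff ?mulf_neq0 ?gt_eqF// mulr_ge0 ?ltW.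
pose F (x : R) : R := 2 * arsinh (c * x).
pose G (t : R) : R := expR (- u * cosh t) * cosh (1 / 2 * t).
have DF (x : R) : is_derive x 1 F (2 * c / Num.sqrt (1 + (c * x) ^+ 2)).
  have D1 : is_derive x 1 (fun y : R => c * y) c.
    by apply: is_derive_eq; rewrite /GRing.scale/=; ring.
  have D2 := is_derive1_comp (g := fun y : R => c * y)
    (is_derive_arsinh (c * x)) D1.
  have D3 := is_deriveZ 2 D2.
  by apply: (is_derive_eq D3); rewrite /GRing.scale/=; ring.
have F'E : derive1 F = (fun x => 2 * c / Num.sqrt (1 + (c * x) ^+ 2)).
  by apply/funext => x; rewrite derive1E; exact: (@derive_val _ _ _ _ _ _ _ (DF x)).
have cF : continuous F.
  move=> x; apply/differentiable_continuous/derivable1_diffP.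
  exact: (@ex_derive _ _ _ _ _ _ _ (DF x)).
have cF' : continuous (derive1 F).
  rewrite F'E => x; apply: cvgMl_tmp; apply: cvgV.
    by rewrite gt_eqF// sqrt1Dsqr_gt0.
  apply: (@continuous_comp _ _ _ (fun x : R => 1 + (c * x) ^+ 2) Num.sqrt).
    apply: cvgD; first exact: cvg_cst.
    apply: (@continuous_comp _ _ _ (fun x : R => c * x) (fun x => x ^+ 2)).
      exact: mulrl_continuous.
    exact: exprn_continuous.
  exact: sqrt_continuous.
have G0 t : 0 <= G t.
  by rewrite mulr_ge0 ?expR_ge0// divr_ge0// addr_ge0 ?expR_ge0.
have F0 : F 0 = 0.
  by rewrite /F /arsinh mulr0 expr0n/= addr0 sqrtr1 add0r ln1 mulr0.
(* cosh (F x / 2) = sqrt (1 + (c x)^2) cancels the denominator of F', and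
   - u cosh (F x) = - u - 2 u c^2 x^2 = - u - x^2. *)
have GF x : ((G \o F) * derive1 F) x = 2 * c * expR (- u) * gauss_fun x.
  rewrite F'E /G /F/= fctE /=.
  have -> : 1 / 2 * (2 * arsinh (c * x)) = arsinh (c * x) by field.
  rewrite cosh_double cosh_arsinh sqrt1DsqrK.
  have -> : - u * (2 * (1 + (c * x) ^+ 2) - 1) = - u - 2 * u * c ^+ 2 * x ^+ 2.
    by ring.
  rewrite cc mul1r expRD /gauss_fun; field.
  by rewrite gt_eqF// sqrt1Dsqr_gt0.
have IE : (\int[@lebesgue_measure R]_(t in `[0%R, +oo[) (G t)%:E
    = (2 * c * expR (- u) * (Num.sqrt pi / 2))%:E)%E.
  (* The lower bound 0 has to be recognized as F 0. *)
  rewrite -{1}F0 increasing_ge0_integration_by_substitutiony.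
  - under eq_integral do rewrite GF EFinM.
    rewrite ge0_integralZl//=.
    + by rewrite integral0y_gauss.
    + apply/measurable_realfun.measurable_EFinP/measurable_funTS; exact: measurable_gauss_fun.
    + by move=> x _; rewrite lee_fin gauss_fun_ge0.
    + by rewrite lee_fin !mulr_ge0 ?expR_ge0 ?ltW.
  - move=> x y _ _ xy; apply: (@gtr0_derive1_lt_oo _ F (x - 1) (y + 1)) => //.
    + by move=> z _; rewrite F'E divr_gt0 ?sqrt1Dsqr_gt0// mulr_gt0.
    + by rewrite in_itv/=; lra.
    + by rewrite in_itv/=; lra.
  - by move=> x _; exact: cF'.
  - apply/cvg_ex; exists (derive1 F 0); apply: cvg_at_right_filter; exact: cF'.
  - apply/cvg_ex; exists (2 * c * 0); rewrite F'E; apply: cvgMl_tmp.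
    apply/gtr0_cvgV0; last exact: cvg_sqrt1Dsqr_pinfty.
    by near=> x; exact: sqrt1Dsqr_gt0.
  - split; last by apply: cvg_at_right_filter; exact: cF.
    by move=> x _; exact: (@ex_derive _ _ _ _ _ _ _ (DF x)).
  - exact: cvg_arsinh_pinfty.
  - apply: continuous_subspaceT => t; apply: cvgM.
      apply: (@continuous_comp _ _ _ (fun t : R => - u * cosh t) expR).
        by apply: cvgMl_tmp; exact: cosh_continuous.
      exact: continuous_expR.
    apply: (@continuous_comp _ _ _ (fun t : R => 1 / 2 * t) cosh).
      exact: mulrl_continuous.
    exact: cosh_continuous.
  - by move=> t _; exact: G0.
rewrite /besselK /Rintegral -/G IE /=.
rewrite /c !sqrtrM ?pi_ge0// sqrtrV//.
have s20 : Num.sqrt 2 != 0 :> R by rewrite gt_eqF// sqrtr_gt0.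
by field; rewrite s20 gt_eqF// sqrtr_gt0.
Unshelve. all: by end_near. Qed.

(** * The derivatives of K and of u^2 K' at order 1/2 *)

Lemma is_derive_besselK_half {R : realType} (u : R) : 0 < u ->
  is_derive u 1 (besselK (1 / 2 : R))
    (- (Num.sqrt (pi / 2) * expR (- u) * (Num.sqrt u + (2 * Num.sqrt u)^-1) / u)).
Proof.
move=> u0; have s0 : 0 < Num.sqrt u by rewrite sqrtr_gt0.
have su : Num.sqrt u ^+ 2 = u by rewrite sqr_sqrtr// ltW.
apply: (@near_eq_is_derive _ _ _
  (fun x : R => Num.sqrt (pi / 2) * ((Num.sqrt x)^-1 * expR (- x)))).
  near=> x; rewrite besselK_half//.
  by near: x; exact: lt_nbhsr.
have D1 := is_derive1_sqrt u0.
have D2 := is_deriveV (lt0r_neq0 s0) D1.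
have D3 : is_derive u 1 (fun x : R => expR (- x)) (- expR (- u)).
  by apply: is_derive_eq; ring.
have D4 := is_deriveZ (Num.sqrt (pi / 2)) (is_deriveM D2 D3).
apply: (is_derive_eq D4); rewrite /GRing.scale/=.
clear D1 D2 D3 D4.
(* Written in terms of s = sqrt u, with u = s^2, this is a rational identity. *)
move: (Num.sqrt u) s0 su (expR (- u)) => s s0 su e; rewrite -su.
by field; rewrite gt_eqF.
Unshelve. all: by end_near. Qed.

Lemma sqr_besselK'_half {R : realType} (u : R) : 0 < u ->
  sqr_besselK' (1 / 2) u =
  - Num.sqrt (pi / 2) * ((u * Num.sqrt u + Num.sqrt u / 2) * expR (- u)).
Proof.
move=> u0; have s0 : 0 < Num.sqrt u by rewrite sqrtr_gt0.
have su : Num.sqrt u ^+ 2 = u by rewrite sqr_sqrtr// ltW.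
rewrite /sqr_besselK' derive1E.
rewrite (@derive_val _ _ _ _ _ _ _ (is_derive_besselK_half _ u0)).
move: (Num.sqrt u) s0 su (expR (- u)) => s s0 su e; rewrite -su.
by field; rewrite gt_eqF.
Qed.

Lemma is_derive_sqr_besselK'_half {R : realType} (u : R) : 0 < u ->
  is_derive u 1 (sqr_besselK' (1 / 2 : R))
    (Num.sqrt (pi / 2) * expR (- u) / Num.sqrt u * (u ^+ 2 - u - 1 / 4)).
Proof.
move=> u0; have s0 : 0 < Num.sqrt u by rewrite sqrtr_gt0.
have su : Num.sqrt u ^+ 2 = u by rewrite sqr_sqrtr// ltW.
apply: (@near_eq_is_derive _ _ _ (fun x : R =>
  - Num.sqrt (pi / 2) * ((x * Num.sqrt x + Num.sqrt x / 2) * expR (- x)))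
  (sqr_besselK' (1 / 2 : R))).
  near=> x; rewrite sqr_besselK'_half//.
  by near: x; exact: lt_nbhsr.
have D1 := is_derive1_sqrt u0.
have D2 := is_deriveM (is_derive_id u 1) D1.
have D3 : is_derive u 1 (fun x : R => expR (- x)) (- expR (- u)).
  by apply: is_derive_eq; ring.
have D4 : is_derive u 1 (fun x : R => Num.sqrt x / 2) ((2 * Num.sqrt u)^-1 / 2).
  by apply: is_derive_eq; rewrite /GRing.scale/=; ring.
have D5 := is_deriveZ (- Num.sqrt (pi / 2)) (is_deriveM (is_deriveD D2 D4) D3).
apply: (is_derive_eq D5); rewrite /GRing.scale/= !fctE/=.
clear D1 D2 D3 D4 D5.
move: (Num.sqrt u) s0 su (expR (- u)) => s s0 su e; rewrite -su.
by field; rewrite gt_eqF.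
Unshelve. all: by end_near. Qed.

(** Positivity of u^2 - u - 1/4 = (u - 1/2)^2 - 1/2 for u > (1 + sqrt 2) / 2. *)
Lemma derive1_sqr_besselK'_half_gt0 {R : realType} (u : R) :
  (1 + Num.sqrt 2) / 2 < u -> 0 < derive1 (sqr_besselK' (1 / 2 : R)) u.
Proof.
move=> ltu; have s2 : 0 < Num.sqrt 2 :> R by rewrite sqrtr_gt0.
have u0 : 0 < u by lra.
have ss : Num.sqrt 2 ^+ 2 = 2 :> R by rewrite sqr_sqrtr.
rewrite derive1E (@derive_val _ _ _ _ _ _ _ (is_derive_sqr_besselK'_half _ u0)).
rewrite mulr_gt0// ?divr_gt0 ?mulr_gt0 ?expR_gt0 ?sqrtr_gt0 ?divr_gt0 ?pi_gt0//.
by nra.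
Qed.

Theorem mainTheorem10 (R : realType) :
  [/\ (forall u : R, u \in `]0, 2[ -> derivable (besselK (1 / 2 : R)) u 1),
      (forall u : R, u \in `](1 + Num.sqrt 2) / 2, 2[ ->
         derivable (sqr_besselK' (1 / 2 : R)) u 1 /\
         0 < derive1 (sqr_besselK' (1 / 2 : R)) u),
      ~ {in `]0, 2[ &, {homo sqr_besselK' (1 / 2 : R) : x y /~ x < y}} &
      ~ (forall nu : R, `|nu| <= 1 / 2 ->
           {in `]0, 2[ &, {homo sqr_besselK' nu : x y /~ x < y}})].
Proof.
have s2 : 0 < Num.sqrt 2 :> R by rewrite sqrtr_gt0.
have s22 : Num.sqrt 2 < 2 :> R.
  have ss : Num.sqrt 2 ^+ 2 = 2 :> R by rewrite sqr_sqrtr.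
  by nra.
have D (u : R) : u \in `](1 + Num.sqrt 2) / 2, 2[ ->
    derivable (sqr_besselK' (1 / 2 : R)) u 1.
  rewrite in_itv/= => /andP[ltu _]; have u0 : 0 < u by lra.
  exact: (@ex_derive _ _ _ _ _ _ _ (is_derive_sqr_besselK'_half _ u0)).
have D0 (u : R) : u \in `](1 + Num.sqrt 2) / 2, 2[ ->
    0 < derive1 (sqr_besselK' (1 / 2 : R)) u.
  by rewrite in_itv/= => /andP[+ _]; exact: derive1_sqr_besselK'_half_gt0.
have notdecr : ~ {in `]0, 2[ &,
    {homo sqr_besselK' (1 / 2 : R) : x y /~ x < y}}.
  move=> decr.
  have : sqr_besselK' (1 / 2) (3 / 2) < sqr_besselK' (1 / 2) (7 / 4) :> R.
    apply: (gtr0_derive1_lt_oo D D0); rewrite ?in_itv/=; try lra.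
    move=> x xI; apply/differentiable_continuous/derivable1_diffP/D.
    by move: xI; rewrite inE.
  by apply/negP; rewrite -leNgt ltW// decr ?in_itv/=; lra.
split=> //.
- move=> u; rewrite in_itv/= => /andP[u0 _].
  exact: (@ex_derive _ _ _ _ _ _ _ (is_derive_besselK_half _ u0)).
- by move=> u uI; split; [exact: D|exact: D0].
- by move=> /(_ (1 / 2)) decr; apply/notdecr/decr; rewrite ger0_norm; lra.
Qed.
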